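(* Let $G=(V,E)$ be a directed graph with $n$ vertices. Then $G$ can be expressed as a Cartesian product of two graphs if and only if there exist $r_1,r_2\in\mathbb N$ with $n=r_1r_2$, an $r_2\times r_2$ binary matrix $B$, and a permutation (ordering) $\{v_{\sigma(1)},v_{\sigma(2)},\ldots,v_{\sigma(n)}\}$ of the vertex set $V$ such that the adjacency matrix $A_G$ of $G$ with respect to this ordering has the block form $$\begin{pmatrix} B_{11} & B_{12} & \cdots & B_{1r_1}\\ B_{21} & B_{22} & \cdots & B_{2r_1}\\ \vdots & \vdots & & \vdots\\ B_{r_11} & B_{r_12} & \cdots & B_{r_1r_1}\end{pmatrix},$$ where each block $B_{ij}$ is an $r_2\times r_2$ matrix, $B_{ij}\in\{0,I\}$ if $i\neq j$, and $B_{ii}\in\{B,\;B*I\}$.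
   Context: Graphs are finite directed graphs (loops allowed, no multiple edges) with $0$-$1$ adjacency matrices. The Cartesian product of $G_1$ and $G_2$ has vertex set $\mathcal V(G_1)\times\mathcal V(G_2)$, with an edge from $(a,b)$ to $(c,d)$ iff either $a=c$ and $bd\in\mathcal E(G_2)$, or $ac\in\mathcal E(G_1)$ and $b=d$. ''$G$ can be expressed as a Cartesian product of two graphs'' means $G$ is isomorphic to the Cartesian product of some graphs $G_1,G_2$ (trivial factorizations with a one-vertex factor being allowed). $I$ is the $r_2\times r_2$ identity matrix, $0$ the zero matrix, and for matrices $P,Q$ of the same size $(P*Q)_{ij}=\max(P_{ij},Q_{ij})$. *)

(* Defs.v *)
From mathcomp Require Import all_boot all_order all_algebra.

Set Implicit Arguments.
Unset Strict Implicit.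
Unset Printing Implicit Defensive.

Import GRing.Theory.
Local Open Scope ring_scope.

Record digraph := Digraph { vertex :> finType; edge : rel vertex }.

Definition digraph_iso (G H : digraph) : Prop :=
  exists2 f : G -> H, bijective f & forall x y, edge (f x) (f y) = edge x y.

Definition cart_edge (G1 G2 : digraph) : rel (G1 * G2) := fun x y =>
  (x.1 == y.1) && edge x.2 y.2 || edge x.1 y.1 && (x.2 == y.2).

Definition cart_prod (G1 G2 : digraph) : digraph := Digraph (@cart_edge G1 G2).

(* 0-1 matrices are represented with entries in nat. *)
Definition binary_mx m n (A : 'M[nat]_(m, n)) : Prop :=
  forall i j, A i j = 0%N \/ A i j = 1%N.

Definition max_mx m n (P Q : 'M[nat]_(m, n)) : 'M[nat]_(m, n) :=
  map2_mx maxn P Q.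

Definition adj_mx (G : digraph) n (v : 'I_n -> G) : 'M[nat]_n :=
  \matrix_(i, j) (edge (v i) (v j) : nat).

Lemma block_size (r1 r2 : nat) : (\sum_(i < r1) r2 = r1 * r2)%N.
Proof. by rewrite sum_nat_const card_ord. Qed.

(* Entry (k, l) of F i j sits at row i * r2 + k and column j * r2 + l; the cast
   only replaces the dimension \sum_(i < r1) r2 of the library's block matrix by
   r1 * r2. *)
Definition block_square_mx r1 r2 (F : 'I_r1 -> 'I_r1 -> 'M[nat]_r2) :
    'M[nat]_(r1 * r2) :=
  castmx (block_size r1 r2, block_size r1 r2) (\mxblock_(i < r1, j < r1) F i j).

(* Main.v *)
Require Import Defs.
From mathcomp Require Import all_boot all_order all_algebra.

(** The block condition says exactly that there are a relation [E] on the block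
    indices and a relation [D] on the positions inside a block such that the
    entry in row [k] of block row [i] and column [l] of block column [j] is the
    truth value of [(i = j and D k l) or (E i j and k = l)]: off the diagonal,
    [0] and [I] record whether [E i j] holds, and on the diagonal, [B] and
    [B * I] record whether [E i i] holds ([block_choiceP]). This is the edge
    relation of the Cartesian product of [E] and [D], up to the bijection
    between the rows of the matrix and the pairs (block, position inside the
    block) given by [block_index]. So an ordering of the vertices of [G] with
    such an adjacency matrix is the same thing as an isomorphism from [G] to a
    Cartesian product whose factors have been enumerated. *)

Local Open Scope ring_scope.

(** The rest of the proof uses the numbering of rows by blocks only as a
    bijection; this lemma contains all the index arithmetic. *)
Lemma block_index (r1 r2 : nat) :
  exists2 g : 'I_r1 * 'I_r2 -> 'I_(r1 * r2), bijective g &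
    forall (F : 'I_r1 -> 'I_r1 -> 'M[nat]_r2) x y,
      block_square_mx F (g x) (g y) = F x.1 y.1 x.2 y.2.
Proof.
pose R (x : 'I_r1 * 'I_r2) := @tagnat.Rank r1 (fun=> r2) x.1 x.2.
pose untag (t : {i : 'I_r1 & 'I_r2}) := (tag t, tagged t).
have bij_R : bijective R.
  exists (untag \o tagnat.sig) => [[i k]|s].
    by rewrite /= /R /tagnat.Rank tagnat.rankK.
  by rewrite -[RHS]tagnat.sigK tagnat.rankE.
exists (fun x => cast_ord (block_size r1 r2) (R x)) => [|F x y].
  apply: bij_comp bij_R.
  by exists (cast_ord (esym (block_size r1 r2)));
    [apply: cast_ordK | apply: cast_ordKV].
rewrite /block_square_mx castmxE !cast_ordK.
have /matrixP/(_ x.2 y.2) := mxblockK (fun i j => F i j) x.1 y.1.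
by rewrite mxE.
Qed.

(** Where [E] has a loop at [i], the diagonal block of [i] gains the edges with
    [k = l], which is the passage from [B] to [B * I]. When [B] has a unit
    diagonal, these two coincide and [F] does not determine [E i i]; either
    value is then correct, because every position already carries a [D]-loop
    and a loop of [E] adds no edge to the product. *)
Lemma block_choiceP (r1 r2 : nat) (F : 'I_r1 -> 'I_r1 -> 'M[nat]_r2) :
  (exists B : 'M[nat]_r2,
     [/\ binary_mx B, forall i j, i <> j -> F i j = 0 \/ F i j = 1%:M
       & forall i, F i i = B \/ F i i = max_mx B 1%:M]) <->
  (exists (E : rel 'I_r1) (D : rel 'I_r2), forall x y,
     F x.1 y.1 x.2 y.2 = @cart_edge (Digraph E) (Digraph D) x y :> nat).
Proof.
split=> [[B [binB offF diagF]]|[E [D FE]]].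
  exists (fun i j => if i == j then F i i != B else F i j == 1%:M).
  exists (fun k l => B k l == 1%N) => -[i k] [j l]; rewrite /cart_edge /=.
  have [<-|neq_ij] /= := eqVneq i j.
    have binBkl : B k l = (B k l == 1%N) :> nat.
      by case: (binB k l) => ->.
    have [->|neqB] /= := eqVneq (F i i) B; first by rewrite orbF.
    have [/eqP|->] := diagF i; first by rewrite (negPf neqB).
    rewrite !mxE /= binBkl.
    by case: (B k l == 1%N) (k == l) => [] [].
  have [->|->] := offF _ _ (elimN eqP neq_ij); last first.
    by rewrite eqxx mxE; case: (k == l).
  (* The matrices [0] and [I] are equal when [r2 = 0]. *)
  rewrite mxE; have [/matrixP/(_ k l)|_] //= := eqVneq (0 : 'M[nat]_r2) 1%:M.
  by rewrite !mxE; case: (k == l).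
have {}FE i j k l : F i j k l = (i == j) && D k l || E i j && (k == l) :> nat.
  exact: (FE (i, k) (j, l)).
exists (\matrix_(k, l) (D k l : nat)); split=> [k l|i j /eqP/negPf neq_ij|i].
- by rewrite mxE; case: (D k l); [right | left].
- by case Eij: (E i j); [right | left]; apply/matrixP => k l;
    rewrite FE neq_ij Eij !mxE /=; case: (k == l).
- case Eii: (E i i); [right | left]; apply/matrixP => k l;
    rewrite FE eqxx Eii !mxE ?orbF //=.
  by case: (D k l) (k == l) => [] [].
Qed.

Theorem corollary6 (G : digraph) (n : nat) (hn : #|G| = n) :
  (exists G1 G2 : digraph, digraph_iso G (cart_prod G1 G2)) <->
  (exists (r1 r2 : nat) (hr : n = (r1 * r2)%N) (B : 'M[nat]_r2)
          (v : 'I_n -> G) (F : 'I_r1 -> 'I_r1 -> 'M[nat]_r2),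
     binary_mx B /\ bijective v /\
     castmx (hr, hr) (adj_mx v) = block_square_mx F /\
     (forall i j, i <> j -> F i j = 0 \/ F i j = 1%:M) /\
     (forall i, F i i = B \/ F i i = max_mx B 1%:M)).
Proof.
split=> [[G1 [G2 [f bij_f fE]]]|].
  have hr : n = (#|G1| * #|G2|)%N by rewrite -hn (bij_eq_card bij_f) card_prod.
  subst n; rewrite hr; set r1 := #|G1|; set r2 := #|G2|.
  have [g [g' gK g'K] gE] := block_index r1 r2.
  have [f' fK f'K] := bij_f.
  have [e1 [e1' e1K e1'K]] : exists e1 : 'I_r1 -> G1, bijective e1.
    by exists enum_val; apply: enum_val_bij.
  have [e2 [e2' e2K e2'K]] : exists e2 : 'I_r2 -> G2, bijective e2.
    by exists enum_val; apply: enum_val_bij.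
  pose h (x : 'I_r1 * 'I_r2) : cart_prod G1 G2 := (e1 x.1, e2 x.2).
  have bij_h : bijective h.
    exists (fun a => (e1' a.1, e2' a.2)) => [[i k]|[a b]].
      by rewrite /= e1K e2K.
    by rewrite /h /= e1'K e2'K.
  pose E : rel 'I_r1 := relpre e1 (@edge G1).
  pose D : rel 'I_r2 := relpre e2 (@edge G2).
  pose F i j : 'M[nat]_r2 := \matrix_(k, l)
    (@cart_edge (Digraph E) (Digraph D) (i, k) (j, l) : nat).
  have /block_choiceP[B [binB offF diagF]] : exists E D, forall x y,
      F x.1 y.1 x.2 y.2 = @cart_edge (Digraph E) (Digraph D) x y :> nat.
    by exists E, D => -[i k] [j l]; rewrite mxE.
  exists r1, r2, erefl, B, (f' \o h \o g'), F; split=> //; split.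
    apply: bij_comp; last by exists g.
    by apply: bij_comp bij_h; exists f.
  rewrite castmx_id; split=> //; apply/matrixP => s t.
  rewrite -(g'K s) -(g'K t) gE !mxE /= !gK -fE !f'K /= /cart_edge /=.
  by rewrite (can_eq e1K) (can_eq e2K).
case=> r1 [r2 [hr [B [v [F [binB [bij_v [vE [offF diagF]]]]]]]]].
clear hn; subst n; rewrite castmx_id in vE.
have /block_choiceP[E [D FE]] : exists B : 'M[nat]_r2,
    [/\ binary_mx B, forall i j, i <> j -> F i j = 0 \/ F i j = 1%:M
      & forall i, F i i = B \/ F i i = max_mx B 1%:M] by exists B.
have [g bij_g gE] := block_index r1 r2.
have [f fK f'K] := bij_comp bij_v bij_g.
exists (Digraph E), (Digraph D), f; first by exists (v \o g).
move=> a b; rewrite -{2}(f'K a) -{2}(f'K b) /=.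
have /matrixP/(_ (g (f a)) (g (f b))) := vE.
by rewrite gE FE mxE; case: cart_edge; case: edge.
Qed.
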